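(* Let $\mathbf{F}\in\{\mathbf{R},\mathbf{C}\}$, let $A_1,\dots,A_n\in\mathbf{H}_d$ be positive semidefinite, let $Z_*=X_*X_*^*$ with $X_*\in\mathbf{F}^{d\times r}$ be positive semidefinite of rank $r$ with eigendecomposition $Z_*=U\Lambda U^*$ ($U^*U=I_r$, smallest nonzero eigenvalue $\lambda_r(Z_* )>0$), let $\xi\in\mathbf{R}^n$ and $y=\mathcal{A}(Z_* )+\xi$. Suppose: (Dual certificate) for some $\epsilon\ge0$ there exists $\lambda\in\mathbf{R}^n$ such that $Y=\mathcal{A}^*(\lambda)$ satisfies $\mathcal{P}_{\mathcal{T}^\perp}(Y)\succeq P_U^\perp$ and $\|\mathcal{P}_{\mathcal{T}}(Y)\|_F\le\epsilon$; (Approximate isometry) for some $\mu_{\mathcal{T}},L_{\mathcal{T}}>0$, $\frac1{\sqrt n}\|\mathcal{A}(H)\|\ge\mu_{\mathcal{T}}\|\mathcal{P}_{\mathcal{T}}(H)\|_F-L_{\mathcal{T}}\operatorname{tr}(\mathcal{P}_{\mathcal{T}^\perp}(H))$ for all $H\in\mathbf{H}_d$ with $\mathcal{P}_{\mathcal{T}^\perp}(H)\succeq0$; and $\mu_{\mathcal{T}}>L_{\mathcal{T}}\epsilon$. Suppose the integer $p$ satisfies $$p>\tau:=2\Big(\frac{1+L_{\mathcal{T}}\sqrt n\|\lambda\|}{\mu_{\mathcal{T}}-L_{\mathcal{T}}\epsilon}\Big)^2\frac{\|\mathcal{A}^*(y)\|_{\mathrm{op}}}{n\lambda_r(Z_*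 )}-2 .$$ Then every second-order critical point $X\in\mathbf{F}^{d\times p}$ of $f_p(X)=\|y-\mathcal{A}(XX^* )\|^2$ satisfies $$\|XX^*-Z_*\|_F\le\|\mathcal{P}_{\mathcal{T}}(XX^*-Z_* )\|_F+\operatorname{tr}\mathcal{P}_{\mathcal{T}^\perp}(XX^* )\le\frac{p+2}{p-\tau}\Big(\frac{1+\epsilon+\sqrt n\|\lambda\|(L_{\mathcal{T}}+\mu_{\mathcal{T}})}{\mu_{\mathcal{T}}-L_{\mathcal{T}}\epsilon}\Big)^2\sqrt{2r}\,\frac{\|\mathcal{A}^*(\xi)\|_{\mathrm{op}}}{n}.$$
   Context: $\mathbf{H}_d$: $d\times d$ Hermitian matrices over $\mathbf{F}$ with real Frobenius inner product $\langle A,B\rangle=\operatorname{Re}\operatorname{tr}(A^*B)$. $\mathcal{A}(S)=(\langle A_1,S\rangle,\dots,\langle A_n,S\rangle)\in\mathbf{R}^n$, $\mathcal{A}^*(z)=\sum_iz_iA_i$. $P_U=UU^*$, $P_U^\perp=I_d-P_U$. $\mathcal{T}=\{UB^*+BU^*:B\in\mathbf{F}^{d\times r}\}\subset\mathbf{H}_d$, with orthogonal projections $\mathcal{P}_{\mathcal{T}}(S)=SP_U+P_USP_U^\perp$ and $\mathcal{P}_{\mathcal{T}^\perp}(S)=P_U^\perp SP_U^\perp$. A second-order critical point is a point where the gradient is zero and the Hessian is positive semidefinite (in the complex case, with respect to real and imaginary parts of $X$). *)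

(* Defs.v *)
From HB Require Import structures.
From mathcomp Require Import all_boot all_order all_algebra.
From mathcomp Require Import all_classical all_reals.
From mathcomp Require Import topology normedtype derive.
From mathcomp.real_closed Require Import complex.

Set Implicit Arguments.
Unset Strict Implicit.
Unset Printing Implicit Defensive.

Import Order.TTheory GRing.Theory Num.Theory.
Import numFieldNormedType.Exports.
Local Open Scope ring_scope.
Local Open Scope classical_set_scope.

(* The scalar field F in {R, C}.  All matrices live in 'M[R[i]]_ ; when
   F = R we require their entries to be real. *)
Variant field_choice := Freal | Fcomplex.

Section Defs.
Variable R : realType.
Local Notation C := (complex R).

Definition inF (F : field_choice) (z : C) : bool :=
  if F is Freal then complex.Im z == 0 else true.

Definition mxF (F : field_choice) m n (A : 'M[C]_(m, n)) : Prop :=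
  forall i j, inF F (A i j).

Definition adj m n (A : 'M[C]_(m, n)) : 'M[C]_(n, m) := (map_mx Num.conj A)^T.

Definition hermitian d (A : 'M[C]_d) : Prop := adj A = A.

Definition inHd (F : field_choice) d (A : 'M[C]_d) : Prop :=
  mxF F A /\ hermitian A.

Definition inner d (A B : 'M[C]_d) : R := complex.Re (\tr (adj A *m B)).
Definition frob d (A : 'M[C]_d) : R := Num.sqrt (inner A A).

(* real part of the trace (the trace of a Hermitian matrix is real) *)
Definition rtr d (A : 'M[C]_d) : R := complex.Re (\tr A).

Definition vnorm d (v : 'cV[C]_d) : R := Num.sqrt (complex.Re ((adj v *m v) 0 0)).

Definition enorm n (z : 'cV[R]_n) : R := Num.sqrt (\sum_i (z i 0) ^+ 2).

Definition psd (F : field_choice) d (A : 'M[C]_d) : Prop :=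
  hermitian A /\
  forall v : 'cV[C]_d, mxF F v -> 0 <= complex.Re ((adj v *m A *m v) 0 0).

Definition loewner_ge (F : field_choice) d (A B : 'M[C]_d) : Prop := psd F (A - B).

Definition opnorm (F : field_choice) d (A : 'M[C]_d) : R :=
  sup [set vnorm (A *m v) | v in [set v : 'cV[C]_d | mxF F v /\ vnorm v = 1]].

Definition Aop n d (As : 'I_n -> 'M[C]_d) (S : 'M[C]_d) : 'cV[R]_n :=
  \col_i inner (As i) S.
Definition Aadj n d (As : 'I_n -> 'M[C]_d) (z : 'cV[R]_n) : 'M[C]_d :=
  \sum_i real_complex R (z i 0) *: As i.

Definition PU d r (U : 'M[C]_(d, r)) : 'M[C]_d := U *m adj U.
Definition PUperp d r (U : 'M[C]_(d, r)) : 'M[C]_d := 1%:M - PU U.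
Definition PT d r (U : 'M[C]_(d, r)) (S : 'M[C]_d) : 'M[C]_d :=
  S *m PU U + PU U *m S *m PUperp U.
Definition PTperp d r (U : 'M[C]_(d, r)) (S : 'M[C]_d) : 'M[C]_d :=
  PUperp U *m S *m PUperp U.

Definition fp n d p (As : 'I_n -> 'M[C]_d) (y : 'cV[R]_n) (X : 'M[C]_(d, p)) : R :=
  enorm (y - Aop As (X *m adj X)) ^+ 2.

(* second-order critical point of f_p on F^{d x p}: the gradient vanishes and
   the Hessian (w.r.t. the real coordinates of X, i.e. real and imaginary parts
   when F = C) is PSD; expressed through directional derivatives along every
   direction D in F^{d x p}. *)
Definition socp (F : field_choice) n d p (As : 'I_n -> 'M[C]_d) (y : 'cV[R]_n)
    (X : 'M[C]_(d, p)) : Prop :=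
  forall D : 'M[C]_(d, p), mxF F D ->
    let phi := fun t : R => fp As y (X + real_complex R t *: D) in
    derive1 phi 0 = 0 /\ 0 <= derive1n 2 phi 0.

End Defs.

(* Main.v *)
(** Write Z = V V^* with V = U sqrt(Lambda), let J solve the least-squares problem
    min |V - X J|, put N = V - X J (so N^* X = 0) and H = X X^* - Z.  Sum the
    second-order condition over the rank-one directions n_j e_k^*, where n_j runs
    over the columns of N.  As the A_i are psd, the curvature term is at most
    4 sum_i <A_i, N N^*> <A_i, X X^*>; since the gradient annihilates everything
    containing a factor X, this becomes
      0 <= 2 <A^* y, N N^*> + (p + 2) (<A^* xi, H> - |A H|^2).
    Pairing N V^* with H shows lambda_r |N|^2 <= |P_T H|^2.  The dual certificate
    and the approximate isometry bound |P_T H| and tr P_T^perp H by multiples of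
    |A H| / sqrt n, so the first term is absorbed when p > tau.  Finally
    <A^* xi, H> <= |A^* xi|_op (sqrt (2 r) |P_T H| + tr P_T^perp H). *)

Require Import Defs.
From HB Require Import structures.
From mathcomp Require Import all_boot all_order all_algebra.
From mathcomp Require Import all_classical all_reals.
From mathcomp Require Import topology normedtype derive.
From mathcomp.real_closed Require Import complex.
From mathcomp Require Import ring lra.
Set Implicit Arguments.
Unset Strict Implicit.
Unset Printing Implicit Defensive.
Import Order.TTheory GRing.Theory Num.Theory.
Import numFieldNormedType.Exports.
Local Open Scope ring_scope.

(** * The real Frobenius inner product on complex matrices and its norm *)

Section FrobeniusProduct.
Variable R : realType.
Local Notation C := (complex R).
Local Notation Re := complex.Re.
Local Notation rc := (real_complex R).

(** [inner] extended to rectangular matrices, so that vectors, factors and square matrices share one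
    calculus; on square matrices the two agree by unfolding. *)
Definition ip m n (A B : 'M[C]_(m, n)) : R := Re (\tr (adj A *m B)).

Lemma ReD (z w : C) : Re (z + w) = Re z + Re w.
Proof. by case: z w => [a b] [c d]. Qed.

Lemma Re_sum (I : finType) (f : I -> C) : Re (\sum_i f i) = \sum_i Re (f i).
Proof. by apply: (big_morph _ ReD). Qed.

Lemma ReZ (a : R) (z : C) : Re (rc a * z) = a * Re z.
Proof. by case: z => [x y] /=; rewrite mul0r subr0. Qed.

Lemma Re_conj (z : C) : Re (Num.conj z) = Re z.
Proof. by case: z. Qed.

Lemma Re_conjM (z : C) : Re (Num.conj z * z) = Re z ^+ 2 + complex.Im z ^+ 2.
Proof. by case: z => [x y] /=; ring. Qed.

Lemma conj_rc (a : R) : Num.conj (rc a) = rc a.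
Proof. by congr Complex; rewrite oppr0. Qed.

Lemma adjE m n (A : 'M[C]_(m, n)) i j : adj A i j = Num.conj (A j i).
Proof. by rewrite !mxE. Qed.

Lemma adjK m n (A : 'M[C]_(m, n)) : adj (adj A) = A.
Proof. by apply/matrixP => i j; rewrite !adjE conjCK. Qed.

Lemma adjD m n (A B : 'M[C]_(m, n)) : adj (A + B) = adj A + adj B.
Proof. by rewrite /adj map_mxD linearD. Qed.

Lemma adjN m n (A : 'M[C]_(m, n)) : adj (- A) = - adj A.
Proof. by rewrite /adj map_mxN linearN. Qed.

Lemma adjB m n (A B : 'M[C]_(m, n)) : adj (A - B) = adj A - adj B.
Proof. by rewrite adjD adjN. Qed.

Lemma adj0 m n : adj (0 : 'M[C]_(m, n)) = 0.
Proof. by rewrite /adj map_mx0 trmx0. Qed.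

Lemma adj_mx1 n : adj (1%:M : 'M[C]_n) = 1%:M.
Proof. by rewrite /adj map_mx1 trmx1. Qed.

Lemma adj_scale m n (a : R) (A : 'M[C]_(m, n)) : adj (rc a *: A) = rc a *: adj A.
Proof. by rewrite /adj map_mxZ linearZ /= conj_rc. Qed.

Lemma adjM m n p (A : 'M[C]_(m, n)) (B : 'M[C]_(n, p)) :
  adj (A *m B) = adj B *m adj A.
Proof. by rewrite /adj map_mxM trmx_mul. Qed.

Lemma tr_adj n (A : 'M[C]_n) : \tr (adj A) = Num.conj (\tr A).
Proof.
rewrite /adj mxtrace_tr /mxtrace rmorph_sum.
by apply: eq_bigr => i _; rewrite mxE.
Qed.

Lemma ipC m n (A B : 'M[C]_(m, n)) : ip A B = ip B A.
Proof. by rewrite /ip -[RHS]Re_conj -tr_adj adjM adjK. Qed.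

Lemma ipDr m n (A B D : 'M[C]_(m, n)) : ip A (B + D) = ip A B + ip A D.
Proof. by rewrite /ip mulmxDr linearD ReD. Qed.

Lemma ipZr m n a (A B : 'M[C]_(m, n)) : ip A (rc a *: B) = a * ip A B.
Proof. by rewrite /ip -scalemxAr linearZ ReZ. Qed.

Lemma ipNr m n (A B : 'M[C]_(m, n)) : ip A (- B) = - ip A B.
Proof. by rewrite -scaleN1r -(rmorphN1 (real_complex R)) ipZr mulN1r. Qed.

Lemma ipBr m n (A B D : 'M[C]_(m, n)) : ip A (B - D) = ip A B - ip A D.
Proof. by rewrite ipDr ipNr. Qed.

Lemma ip0r m n (A : 'M[C]_(m, n)) : ip A 0 = 0.
Proof. by rewrite /ip mulmx0 mxtrace0. Qed.

Lemma ip_sumr (I : finType) m n (A : 'M[C]_(m, n)) (F : I -> 'M[C]_(m, n)) :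
  ip A (\sum_i F i) = \sum_i ip A (F i).
Proof. by apply: (big_morph _ (ipDr A)); rewrite ip0r. Qed.

Lemma ipDl m n (A B D : 'M[C]_(m, n)) : ip (A + B) D = ip A D + ip B D.
Proof. by rewrite !(ipC _ D) ipDr. Qed.

Lemma ipNl m n (A B : 'M[C]_(m, n)) : ip (- A) B = - ip A B.
Proof. by rewrite !(ipC _ B) ipNr. Qed.

Lemma ipBl m n (A B D : 'M[C]_(m, n)) : ip (A - B) D = ip A D - ip B D.
Proof. by rewrite ipDl ipNl. Qed.

Lemma ipZl m n a (A B : 'M[C]_(m, n)) : ip (rc a *: A) B = a * ip A B.
Proof. by rewrite ipC ipZr ipC. Qed.

Lemma ip_suml (I : finType) m n (B : 'M[C]_(m, n)) (F : I -> 'M[C]_(m, n)) :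
  ip (\sum_i F i) B = \sum_i ip (F i) B.
Proof. by rewrite ipC ip_sumr; apply: eq_bigr => i _; rewrite ipC. Qed.

Lemma ip_mull m n p (A : 'M[C]_(m, n)) (B : 'M[C]_(n, p)) D :
  ip (A *m B) D = ip B (adj A *m D).
Proof. by rewrite /ip adjM mulmxA. Qed.

Lemma ip_mulr m n p (A : 'M[C]_(m, n)) (B : 'M[C]_(n, p)) D :
  ip (A *m B) D = ip A (D *m adj B).
Proof. by rewrite /ip adjM -mulmxA mxtrace_mulC mulmxA. Qed.

Lemma ip_adj m n (A B : 'M[C]_(m, n)) : ip (adj A) (adj B) = ip A B.
Proof. by rewrite [RHS]ipC /ip adjK mxtrace_mulC. Qed.

Lemma ip_cols m n (A B : 'M[C]_(m, n)) :
  ip A B = \sum_k ip (col k A) (col k B).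
Proof.
rewrite /ip {1}/mxtrace Re_sum; apply: eq_bigr => k _.
rewrite /mxtrace big_ord1 !mxE; congr Re.
by apply: eq_bigr => i _; rewrite !mxE.
Qed.

Lemma ip_sqE m n (A : 'M[C]_(m, n)) :
  ip A A = \sum_j \sum_i (Re (A i j) ^+ 2 + complex.Im (A i j) ^+ 2).
Proof.
rewrite /ip /mxtrace Re_sum; apply: eq_bigr => j _.
by rewrite mxE Re_sum; apply: eq_bigr => i _; rewrite adjE Re_conjM.
Qed.

Lemma ip_ge0 m n (A : 'M[C]_(m, n)) : 0 <= ip A A.
Proof.
by rewrite ip_sqE; do 2!apply: sumr_ge0 => ? _; rewrite addr_ge0 ?sqr_ge0.
Qed.

Lemma ip_eq0 m n (A : 'M[C]_(m, n)) : ip A A = 0 -> A = 0.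
Proof.
rewrite ip_sqE => /eqP.
have h0 i j : 0 <= Re (A i j) ^+ 2 + complex.Im (A i j) ^+ 2.
  by rewrite addr_ge0 ?sqr_ge0.
rewrite psumr_eq0 => [/allP h|j _]; last exact: sumr_ge0.
apply/matrixP => i j; rewrite mxE.
have := h j (mem_index_enum _); rewrite /= psumr_eq0 //.
move=> /allP/(_ i (mem_index_enum _)).
rewrite /= paddr_eq0 ?sqr_ge0 // !sqrf_eq0.
by case: (A i j) => x y /= /andP[/eqP -> /eqP ->].
Qed.

(** A quadratic that is nonnegative everywhere is so at its minimiser [- b / c]. The Cauchy-Schwarz
    inequalities for [ip], for finite sums and for psd forms all come from this. *)
Lemma discr_bound (a b c : R) : 0 <= c ->
  (forall t, 0 <= a + 2 * t * b + t ^+ 2 * c) -> b ^+ 2 <= a * c.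
Proof.
move=> c0 h; have [c1|c1] := eqVneq c 0.
  have [->|b0] := eqVneq b 0; first by rewrite c1; lra.
  (* For [c = 0] the polynomial is affine, and this point gives it the value -1. *)
  have := h (- (a + 1) / (2 * b)).
  have -> : a + 2 * (- (a + 1) / (2 * b)) * b + (- (a + 1) / (2 * b)) ^+ 2 * c = -1.
    by rewrite c1; field.
  lra.
have cp : 0 < c by rewrite lt_neqAle eq_sym c1.
have := h (- b / c).
have -> : a + 2 * (- b / c) * b + (- b / c) ^+ 2 * c = (a * c - b ^+ 2) / c by field.
by rewrite pmulr_lge0 ?invr_gt0 // subr_ge0.
Qed.

Lemma ip_CS m n (A B : 'M[C]_(m, n)) : ip A B ^+ 2 <= ip A A * ip B B.
Proof.
apply: discr_bound => [|t]; first exact: ip_ge0.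
have := ip_ge0 (A + rc t *: B).
by rewrite !(ipDl, ipDr, ipZl, ipZr) (ipC B A); congr (_ <= _); ring.
Qed.

Lemma sum_CS (I : finType) (x y : I -> R) :
  (\sum_i x i * y i) ^+ 2 <= (\sum_i x i ^+ 2) * (\sum_i y i ^+ 2).
Proof.
apply: discr_bound => [|t]; first by apply: sumr_ge0 => i _; exact: sqr_ge0.
have : 0 <= \sum_i (x i + t * y i) ^+ 2 by apply: sumr_ge0 => i _; exact: sqr_ge0.
congr (_ <= _); rewrite !mulr_sumr -!big_split /=.
by apply: eq_bigr => i _; ring.
Qed.

Definition nm m n (A : 'M[C]_(m, n)) : R := Num.sqrt (ip A A).

Lemma nm_ge0 m n (A : 'M[C]_(m, n)) : 0 <= nm A.
Proof. exact: sqrtr_ge0. Qed.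

Lemma nm_sq m n (A : 'M[C]_(m, n)) : nm A ^+ 2 = ip A A.
Proof. by rewrite sqr_sqrtr ?ip_ge0. Qed.

Lemma ip_le_nm m n (A B : 'M[C]_(m, n)) : ip A B <= nm A * nm B.
Proof.
apply: (le_trans (ler_norm _)).
by rewrite -sqrtr_sqr -sqrtrM ?ip_ge0 // ler_wsqrtr // ip_CS.
Qed.

Lemma nm_le m n m' n' (A : 'M[C]_(m, n)) (B : 'M[C]_(m', n')) :
  (nm A <= nm B) = (ip A A <= ip B B).
Proof. by rewrite ler_sqrt // ip_ge0. Qed.

Lemma nm_triangle m n (A B : 'M[C]_(m, n)) : nm (A + B) <= nm A + nm B.
Proof.
rewrite -(ler_pXn2r (n := 2)) ?nnegrE ?addr_ge0 ?nm_ge0 //.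
rewrite nm_sq !(ipDl, ipDr) (ipC B A) -!nm_sq.
have := ip_le_nm A B; nra.
Qed.

Lemma ip_cV n (v w : 'cV[C]_n) : ip v w = Re ((adj v *m w) 0 0).
Proof. by rewrite /ip /mxtrace big_ord1. Qed.

Lemma ip_outer n m (w : 'cV[C]_m) (v : 'cV[C]_n) :
  ip (w *m adj v) (w *m adj v) = ip w w * ip v v.
Proof.
rewrite !ip_sqE !big_ord1 mulrC mulr_suml; apply: eq_bigr => j _.
rewrite mulr_sumr; apply: eq_bigr => i _.
rewrite !mxE big_ord1 !mxE.
by case: (w i 0) (v j 0) => a b [c e] /=; ring.
Qed.

(** Cauchy-Schwarz for [A] against the rank-one matrix [A v v^*], then division by [|A v|^2]. *)
Lemma ip_mul_col_le m n (A : 'M[C]_(m, n)) (v : 'cV[C]_n) :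
  ip (A *m v) (A *m v) <= ip A A * ip v v.
Proof.
have [->|x0] := eqVneq (ip (A *m v) (A *m v)) 0; first by rewrite mulr_ge0 ?ip_ge0.
have xp : 0 < ip (A *m v) (A *m v) by rewrite lt_neqAle eq_sym x0 ip_ge0.
have := ip_CS A (A *m v *m adj v).
rewrite -ip_mulr ip_outer expr2 mulrCA ler_pM2l //.
Qed.

Lemma col_mulmx m n p (A : 'M[C]_(m, n)) (B : 'M[C]_(n, p)) k :
  col k (A *m B) = A *m col k B.
Proof. by rewrite !colE mulmxA. Qed.

Lemma ip_mul_le m n p (A : 'M[C]_(m, n)) (B : 'M[C]_(n, p)) :
  ip (A *m B) (A *m B) <= ip A A * ip B B.
Proof.
rewrite [ip (A *m B) _]ip_cols [ip B B]ip_cols mulr_sumr.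
by apply: ler_sum => k _; rewrite !col_mulmx ip_mul_col_le.
Qed.

(** The right side is the trace of [N N^*]; submultiplicativity takes the place of an argument with
    eigenvalues. *)
Lemma nm_gram_le m n (N : 'M[C]_(m, n)) : nm (N *m adj N) <= ip N N.
Proof.
rewrite -[leRHS]ger0_norm ?ip_ge0 // -sqrtr_sqr ler_wsqrtr //.
by rewrite (le_trans (ip_mul_le _ _)) // ip_adj expr2.
Qed.

Lemma vnormE n (v : 'cV[C]_n) : vnorm v = nm v.
Proof. by rewrite /nm ip_cV. Qed.

Lemma nmZ m n (a : R) (A : 'M[C]_(m, n)) : nm (rc a *: A) = `|a| * nm A.
Proof. by rewrite /nm ipZl ipZr mulrA -expr2 sqrtrM ?sqr_ge0 // sqrtr_sqr. Qed.

(** * Closure properties of matrices over F, psd forms and the operator norm *)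

Section ScalarField.
Variable F : field_choice.

Lemma inFD z w : inF F z -> inF F w -> @inF R F (z + w).
Proof. by case: F z w => [] [a b] [c e] //= /eqP -> /eqP ->; rewrite addr0. Qed.

Lemma inFM z w : inF F z -> inF F w -> @inF R F (z * w).
Proof.
by case: F z w => [] [a b] [c e] //= /eqP -> /eqP ->; rewrite mulr0 mul0r addr0.
Qed.

Lemma inF_conj z : inF F z -> @inF R F (Num.conj z).
Proof. by case: F z => [] [a b] //= /eqP ->; rewrite oppr0. Qed.

Lemma inF_rc a : inF F (rc a).
Proof. by case: F => //=. Qed.

Lemma inF_sum (I : finType) (f : I -> C) :
  (forall i, inF F (f i)) -> inF F (\sum_i f i).
Proof. by move=> h; elim/big_ind: _ => //; [exact: (inF_rc 0)|exact: inFD]. Qed.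

Lemma mxFM m n p (A : 'M[C]_(m, n)) (B : 'M[C]_(n, p)) :
  mxF F A -> mxF F B -> mxF F (A *m B).
Proof. by move=> hA hB i j; rewrite mxE; apply: inF_sum => k; apply: inFM. Qed.

Lemma mxF_adj m n (A : 'M[C]_(m, n)) : mxF F A -> mxF F (adj A).
Proof. by move=> hA i j; rewrite adjE; apply: inF_conj. Qed.

Lemma mxFZ m n a (A : 'M[C]_(m, n)) : mxF F A -> mxF F (rc a *: A).
Proof. by move=> hA i j; rewrite mxE; apply: inFM => //; exact: inF_rc. Qed.

Lemma mxFD m n (A B : 'M[C]_(m, n)) : mxF F A -> mxF F B -> mxF F (A + B).
Proof. by move=> hA hB i j; rewrite mxE; apply: inFD. Qed.

Lemma mxFN m n (A : 'M[C]_(m, n)) : mxF F A -> mxF F (- A).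
Proof. by move/(mxFZ (-1)); rewrite rmorphN1 scaleN1r. Qed.

Lemma mxFB m n (A B : 'M[C]_(m, n)) : mxF F A -> mxF F B -> mxF F (A - B).
Proof. by move=> hA hB; apply: mxFD => //; apply: mxFN. Qed.

Lemma mxF_delta m n (i : 'I_m) (j : 'I_n) : mxF F (delta_mx i j : 'M[C]_(m, n)).
Proof.
by move=> a b; rewrite mxE; case: (_ && _); [exact: (inF_rc 1)|exact: (inF_rc 0)].
Qed.

Lemma mxF1 n : mxF F (1%:M : 'M[C]_n).
Proof.
by move=> a b; rewrite mxE; case: (_ == _); [exact: (inF_rc 1)|exact: (inF_rc 0)].
Qed.

Lemma mxF_diag n (l : 'rV[R]_n) : mxF F (diag_mx (map_mx (real_complex R) l)).
Proof.
by move=> a b; rewrite !mxE; case: (_ == _); [exact: inF_rc|exact: (inF_rc 0)].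
Qed.

Lemma mxF_col m n (A : 'M[C]_(m, n)) k : mxF F A -> mxF F (col k A).
Proof. by move=> hA i j; rewrite mxE. Qed.

Lemma mxF_sum (I : finType) m n (f : I -> 'M[C]_(m, n)) :
  (forall i, mxF F (f i)) -> mxF F (\sum_i f i).
Proof. by move=> h i j; rewrite summxE; apply: inF_sum => k; apply: h. Qed.

(* The pseudo-inverse commutes with conjugation, so a real matrix has a real one. *)
Lemma mxF_pinv m n (A : 'M[C]_(m, n)) : mxF F A -> mxF F (pinvmx A).
Proof.
rewrite /mxF; case: F => // hA i j.
have cA : map_mx Num.conj A = A.
  apply/matrixP => a b; rewrite mxE; have := hA a b.
  by case: (A a b) => x y /= /eqP ->; congr Complex; rewrite oppr0.
have : pinvmx A i j = Num.conj (pinvmx A i j).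
  by rewrite -{1}cA -map_pinvmx mxE.
by case: (pinvmx A i j) => x y [/eqP]; rewrite -addr_eq0 -mulr2n mulrn_eq0.
Qed.

Lemma psd_ip d (A : 'M[C]_d) : psd F A ->
  forall v : 'cV[C]_d, mxF F v -> 0 <= ip v (A *m v).
Proof. by move=> [_ h] v /h; rewrite ip_cV mulmxA. Qed.

Lemma ip_herm d m (A : 'M[C]_d) (B D : 'M[C]_(d, m)) : Defs.hermitian A ->
  ip (A *m B) D = ip B (A *m D).
Proof. by move=> hA; rewrite ip_mull hA. Qed.

Lemma psd_CS d (A : 'M[C]_d) (u v : 'cV[C]_d) : psd F A -> mxF F u -> mxF F v ->
  ip u (A *m v) ^+ 2 <= ip u (A *m u) * ip v (A *m v).
Proof.
move=> pA hu hv; have hA := pA.1.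
apply: discr_bound => [|t]; first exact: psd_ip.
have := psd_ip pA (mxFD hu (mxFZ t hv)).
rewrite mulmxDr -scalemxAr !(ipDl, ipDr, ipZl, ipZr).
rewrite -(ip_herm v u hA) (ipC (A *m v) u).
by congr (_ <= _); ring.
Qed.

(** Turns pairings with [N N^*] into quadratic forms at single vectors, the only objects that [psd]
    and [opnorm] test. *)
Lemma ip_gram d m (A : 'M[C]_d) (N : 'M[C]_(d, m)) : Defs.hermitian A ->
  ip A (N *m adj N) = \sum_k ip (col k N) (A *m col k N).
Proof.
move=> hA; rewrite -{1}[N]adjK -ip_mulr adjK ip_herm // ip_cols.
by apply: eq_bigr => k _; rewrite col_mulmx.
Qed.

Lemma psd_gram_ge0 d m (A : 'M[C]_d) (N : 'M[C]_(d, m)) :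
  psd F A -> mxF F N -> 0 <= ip A (N *m adj N).
Proof.
move=> pA hN; rewrite (ip_gram _ pA.1); apply: sumr_ge0 => k _.
by apply: (psd_ip pA); exact: mxF_col.
Qed.

Lemma gram_psd d m (N : 'M[C]_(d, m)) : psd F (N *m adj N).
Proof.
split; first by rewrite /Defs.hermitian adjM adjK.
by move=> v _; rewrite -mulmxA -ip_cV -mulmxA -{1}[N]adjK -ip_mull ip_ge0.
Qed.

Lemma opnorm_bound d (A : 'M[C]_d) (v : 'cV[C]_d) :
  mxF F v -> nm (A *m v) <= opnorm F A * nm v.
Proof.
move=> hv; have [v0|v0] := eqVneq (nm v) 0.
  have -> : v = 0 by apply: ip_eq0; rewrite -nm_sq v0 expr0n.
  by rewrite mulmx0 /nm ip0r sqrtr0 mulr0.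
have vp : 0 < nm v by rewrite lt_neqAle eq_sym v0 nm_ge0.
set u := rc (nm v)^-1 *: v.
have hu : mxF F u /\ vnorm u = 1.
  split; first exact: mxFZ.
  by rewrite vnormE nmZ ger0_norm ?invr_ge0 ?nm_ge0 // mulVf.
have -> : nm (A *m v) = vnorm (A *m u) * nm v.
  rewrite vnormE -scalemxAr nmZ ger0_norm ?invr_ge0 ?nm_ge0 //.
  by rewrite mulrAC mulVf // mul1r.
(* The supremum dominates its elements once the set is nonempty and bounded; the Frobenius norm of
   [A] serves as a bound. *)
rewrite ler_pM2r //; apply: sup_upper_bound; last by exists u.
split; first by exists (vnorm (A *m u)); exists u.
exists (nm A) => _ [w [_ w1]] <-; rewrite vnormE nm_le.
by rewrite (le_trans (ip_mul_le _ _)) // -(nm_sq w) -vnormE w1 expr1n mulr1.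
Qed.

(** Without unit vectors, as for [d = 0], the supremum is over the empty set and has the default
    value 0. *)
Lemma opnorm_ge0 d (A : 'M[C]_d) : 0 <= opnorm F A.
Proof.
have [[v [hv v1]]|nex] := pselect (exists v : 'cV[C]_d, mxF F v /\ vnorm v = 1).
  have := opnorm_bound A hv; rewrite -(vnormE v) v1 mulr1.
  exact: le_trans (nm_ge0 _).
by rewrite /opnorm sup_out // => -[[x [v hv _]] _]; apply: nex; exists v.
Qed.

Lemma opnorm_gram d m (B : 'M[C]_d) (N : 'M[C]_(d, m)) :
  Defs.hermitian B -> mxF F N ->
  ip B (N *m adj N) <= opnorm F B * ip N N.
Proof.
move=> hB hN; rewrite ip_gram // [ip N N]ip_cols mulr_sumr.
apply: ler_sum => k _; apply: (le_trans (ip_le_nm _ _)).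
rewrite -nm_sq expr2 mulrCA ler_wpM2l ?nm_ge0 //.
by apply: opnorm_bound; exact: mxF_col.
Qed.

Lemma opnorm_mul d m (B : 'M[C]_d) (N : 'M[C]_(d, m)) : mxF F N ->
  ip (B *m N) (B *m N) <= opnorm F B ^+ 2 * ip N N.
Proof.
move=> hN; rewrite [ip (B *m N) _]ip_cols [ip N N]ip_cols mulr_sumr.
apply: ler_sum => k _; rewrite -!nm_sq -exprMn col_mulmx ler_sqr ?nnegrE ?nm_ge0 //.
  by apply: opnorm_bound; exact: mxF_col.
apply: (le_trans (nm_ge0 (B *m col k N))).
by apply: opnorm_bound; exact: mxF_col.
Qed.

End ScalarField.
End FrobeniusProduct.

(** * Tangent and normal projections, and the least-squares fit *)

Section Tangent.
Variable R : realType.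
Local Notation C := (complex R).
Local Notation rc := (real_complex R).
Variable F : field_choice.

Section Projections.
Variables (d r : nat) (U : 'M[C]_(d, r)).
Hypothesis hU : adj U *m U = 1%:M.
Implicit Types A B S : 'M[C]_d.

Lemma adj_PU : adj (PU U) = PU U.
Proof. by rewrite /PU adjM adjK. Qed.

Lemma adj_PUperp : adj (PUperp U) = PUperp U.
Proof. by rewrite /PUperp adjB adj_mx1 adj_PU. Qed.

Lemma PU_U : PU U *m U = U.
Proof. by rewrite /PU -mulmxA hU mulmx1. Qed.

Lemma PUperp_U : PUperp U *m U = 0.
Proof. by rewrite /PUperp mulmxBl mul1mx PU_U subrr. Qed.

Lemma PUperp_PU : PUperp U *m PU U = 0.
Proof. by rewrite /PU mulmxA PUperp_U mul0mx. Qed.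

Lemma PU_PUperp : PU U *m PUperp U = 0.
Proof. by rewrite -adj_PU -adj_PUperp -adjM PUperp_PU adj0. Qed.

Lemma PUperp_idem : PUperp U *m PUperp U = PUperp U.
Proof. by rewrite [X in _ *m X = _]/PUperp mulmxBr mulmx1 PUperp_PU subr0. Qed.

Lemma PTD_PTperp S : PT U S + PTperp U S = S.
Proof.
rewrite /PT /PTperp -addrA -!mulmxDl.
by rewrite /PUperp (addrC (PU U)) subrK mul1mx mulmxBr mulmx1 addrC subrK.
Qed.

(** Each summand of [PT U A] has a factor [PU U] on one side; moved across, it meets [PUperp U] and
    gives zero. *)
Lemma ip_PT_PTperp A B : ip (PT U A) (PTperp U B) = 0.
Proof.
rewrite /PT /PTperp ipDl ip_mulr -mulmxA adj_PU PUperp_PU !mulmx0 ip0r add0r.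
by rewrite -mulmxA ip_mull adj_PU !mulmxA PU_PUperp !mul0mx ip0r.
Qed.

Lemma ip_PT A B : ip (PT U A) B = ip (PT U A) (PT U B).
Proof. by rewrite -{1}(PTD_PTperp B) ipDr ip_PT_PTperp addr0. Qed.

Lemma ip_PTperp A B : ip (PTperp U A) B = ip (PTperp U A) (PTperp U B).
Proof. by rewrite -{1}(PTD_PTperp B) ipDr ipC ip_PT_PTperp add0r. Qed.

Lemma ip_PT_sq S : ip (PT U S) (PT U S) =
  ip (S *m PU U) (S *m PU U) + ip (PU U *m S *m PUperp U) (PU U *m S *m PUperp U).
Proof.
have h : ip (S *m PU U) (PU U *m S *m PUperp U) = 0.
  by rewrite ip_mulr adj_PU -[_ *m PU U]mulmxA PUperp_PU mulmx0 ip0r.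
by rewrite /PT !(ipDl, ipDr) (ipC (PU U *m _ *m _)) h addr0 add0r.
Qed.

Lemma ip_PUperp_le m (A : 'M[C]_(m, d)) :
  ip (A *m PUperp U) (A *m PUperp U) <= ip A A.
Proof.
have h : ip (A *m PUperp U) (A *m PU U) = 0.
  by rewrite ip_mulr adj_PUperp -mulmxA PU_PUperp mulmx0 ip0r.
have e : A = A *m PUperp U + A *m PU U by rewrite -mulmxDr subrK mulmx1.
rewrite [leRHS](_ : _ = ip (A *m PUperp U) (A *m PUperp U)
  + ip (A *m PU U) (A *m PU U)).
  by rewrite lerDl ip_ge0.
by rewrite {1 2}e !(ipDl, ipDr) (ipC (A *m PU U) (A *m PUperp U)) h addr0 add0r.
Qed.

Lemma PTperp_gram m (N : 'M[C]_(d, m)) :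
  PTperp U (N *m adj N) = (PUperp U *m N) *m adj (PUperp U *m N).
Proof. by rewrite /PTperp adjM adj_PUperp !mulmxA. Qed.

Lemma PTperpB A B : PTperp U (A - B) = PTperp U A - PTperp U B.
Proof. by rewrite /PTperp (mulmxBr _ A B) mulmxBl. Qed.

Lemma mxF_PU : mxF F U -> mxF F (PU U).
Proof. by move=> h; apply: mxFM => //; exact: mxF_adj. Qed.

Lemma mxF_PUperp : mxF F U -> mxF F (PUperp U).
Proof. by move=> h; apply: mxFB; [exact: mxF1 | exact: mxF_PU]. Qed.

(** The two orthogonal pieces of [PT U B] each have squared norm at most [|B P_U|^2], the second
    because [B] is Hermitian. Since [|B P_U| = |B U|] and [|U|^2 = r], this is at most r times the
    squared operator norm. *)
Lemma nm_PT_le B : mxF F U -> Defs.hermitian B ->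
  nm (PT U B) <= Num.sqrt (2 * r%:R) * opnorm F B.
Proof.
move=> FU hB; rewrite -(ger0_norm (opnorm_ge0 F B)) -sqrtr_sqr -sqrtrM ?mulr_ge0 //.
have UU : ip U U = r%:R by rewrite /ip hU mxtrace1 -(rmorph_nat (real_complex R)).
have BU : ip (B *m PU U) (B *m PU U) <= opnorm F B ^+ 2 * r%:R.
  rewrite {1}/PU mulmxA ip_mulr adjK -[_ *m adj U *m U]mulmxA hU mulmx1 -UU.
  exact: opnorm_mul.
apply: ler_wsqrtr; rewrite ip_PT_sq.
have := ip_PUperp_le (PU U *m B); rewrite -[ip (_ *m B) _]ip_adj adjM hB adj_PU.
lra.
Qed.

End Projections.

Lemma trace_gram d m (N : 'M[C]_(d, m)) : rtr (N *m adj N) = ip N N.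
Proof. by rewrite /rtr /ip mxtrace_mulC. Qed.

(** Whatever [X^* X] kills on its right is killed by [X], because [|X K|^2 = <K, X^* X K>]; here [K]
    is the cokernel. *)
Lemma submx_gram m n (X : 'M[C]_(m, n)) : (X <= adj X *m X)%MS.
Proof.
rewrite submxE; apply/eqP; apply: ip_eq0.
by rewrite ip_mull mulmxA mulmx_coker ip0r.
Qed.

(** The conclusion is the normal equation of the fit. It is solvable even for rank-deficient [X],
    since the rows of [V^* X] lie in the row space of [X^* X]; the pseudo-inverse keeps the solution
    over F. *)
Lemma least_squares d p m (X : 'M[C]_(d, p)) (V : 'M[C]_(d, m)) :
  mxF F X -> mxF F V ->
  exists2 J, mxF F J & adj (V - X *m J) *m X = 0.
Proof.
move=> FX FV.
exists (adj (adj V *m X *m pinvmx (adj X *m X))).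
  apply: mxF_adj; apply: mxFM; first by apply: mxFM => //; exact: mxF_adj.
  by apply: mxF_pinv; apply: mxFM => //; exact: mxF_adj.
rewrite adjB adjM adjK mulmxBl -[_ *m adj X *m X]mulmxA mulmxKpV ?subrr //.
exact: submx_trans (submxMl _ _) (submx_gram X).
Qed.

End Tangent.

(** * First- and second-order conditions at a critical point *)

Section CriticalPoints.
Variable R : realType.
Local Notation C := (complex R).
Local Notation rc := (real_complex R).
Variables (F : field_choice) (n d : nat) (As : 'I_n -> 'M[C]_d).

Lemma AopE S i : Aop As S i 0 = ip (As i) S.
Proof. by rewrite mxE. Qed.

Lemma subAopE z S i : (z - Aop As S) i 0 = z i 0 - ip (As i) S.
Proof. by rewrite !mxE. Qed.

Lemma ip_Aadj z S : ip (Aadj As z) S = \sum_i z i 0 * ip (As i) S.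
Proof. by rewrite ip_suml; apply: eq_bigr => i _; rewrite ipZl. Qed.

Lemma enorm_sq m (z : 'cV[R]_m) : enorm z ^+ 2 = \sum_i z i 0 ^+ 2.
Proof. by rewrite sqr_sqrtr // sumr_ge0 // => i _; exact: sqr_ge0. Qed.

Lemma Aadj_herm z : (forall i, Defs.hermitian (As i)) -> Defs.hermitian (Aadj As z).
Proof.
move=> h; rewrite /Defs.hermitian /Aadj.
rewrite (big_morph (@adj R d d) (@adjD R d d) (adj0 R d d)).
by apply: eq_bigr => i _; rewrite adj_scale h.
Qed.

(** [phi] is a polynomial function, so its analytic derivatives are formal ones evaluated at 0. *)
Lemma derive_quadratic_sq (e b c : 'I_n -> R) :
  let phi t := \sum_i (e i - t * b i - t ^+ 2 * c i) ^+ 2 in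
  derive1 phi 0 = - 2 * \sum_i e i * b i /\
  derive1n 2 phi 0 = 2 * \sum_i b i ^+ 2 - 4 * \sum_i e i * c i.
Proof.
move=> phi.
pose P : {poly R} := \sum_i ((e i)%:P - (b i)%:P * 'X - (c i)%:P * 'X ^+ 2) ^+ 2.
have -> : phi = horner P.
  apply/funext => t; rewrite /phi /P horner_sum; apply: eq_bigr => i _.
  by rewrite !hornerE /=; ring.
rewrite /derive1n /= -!derivE /P !(raddf_sum (@deriv R)) !horner_sum mulr_sumr.
split; last rewrite !mulr_sumr -sumrB; apply: eq_bigr => i _.
  by rewrite /= !expr2 !poly.derivE !hornerE /=; ring.
by rewrite /= !expr2 !poly.derivE !hornerE /=; ring.
Qed.

Section Socp.
Variables (p : nat) (y : 'cV[R]_n) (X : 'M[C]_(d, p)).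
Hypothesis hX : socp F As y X.
Local Notation e := (y - Aop As (X *m adj X)).

(** Along [X + t D] the residual is [e] minus a linear and a quadratic term in [t], which makes both
    derivatives explicit; constant factors are divided out. *)
Lemma socp_conditions (D : 'M[C]_(d, p)) : mxF F D ->
  \sum_i e i 0 * ip (As i) (X *m adj D + D *m adj X) = 0 /\
  0 <= \sum_i ip (As i) (X *m adj D + D *m adj X) ^+ 2
         - 2 * \sum_i e i 0 * ip (As i) (D *m adj D).
Proof.
move=> FD; have := hX FD; cbv zeta.
have -> : (fun t : R => fp As y (X + rc t *: D)) =
   (fun t => \sum_i (e i 0 - t * ip (As i) (X *m adj D + D *m adj X)
                      - t ^+ 2 * ip (As i) (D *m adj D)) ^+ 2).
  apply/funext => t; rewrite /fp enorm_sq; apply: eq_bigr => i _; congr (_ ^+ 2).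
  rewrite !subAopE adjD adj_scale mulmxDl !mulmxDr.
  rewrite -!scalemxAl -!scalemxAr -!addrA !ipDr !ipZr.
  by move: (ip _ _) (ip _ _) (ip _ _) (ip _ _) => *; ring.
have [-> ->] := derive_quadratic_sq (fun i => e i 0)
  (fun i => ip (As i) (X *m adj D + D *m adj X)) (fun i => ip (As i) (D *m adj D)).
by move=> [h1 h2]; split; lra.
Qed.

Hypothesis hA : forall i, mxF F (As i) /\ psd F (As i).
Local Notation B := (Aadj As e).

(** For Hermitian [B] the two halves of [X D^* + D X^*] pair equally, so the vanishing first-order
    term is twice this pairing. *)
Lemma socp_gradient (D : 'M[C]_(d, p)) : mxF F D -> ip B (X *m adj D) = 0.
Proof.
move=> FD; have [+ _] := socp_conditions FD; rewrite -ip_Aadj ipDr.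
have hB : Defs.hermitian B by apply: Aadj_herm => i; have [_ []] := hA i.
have -> : ip B (D *m adj X) = ip B (X *m adj D).
  by rewrite -ip_adj hB adjM adjK.
lra.
Qed.

Hypothesis FX : mxF F X.

(** All directions [u e_k^*] have the same Gram matrix [u u^*], so summing over the p indices k
    multiplies the [B] term by p, while the columns of [X] in the curvature terms add up to
    [X X^*]. *)
Lemma socp_hessian_col (u : 'cV[C]_d) : mxF F u ->
  0 <= 2 * \sum_i ip u (As i *m u) * ip (As i) (X *m adj X) - p%:R * ip u (B *m u).
Proof.
move=> Fu.
have hAi i : Defs.hermitian (As i) by have [_ []] := hA i.
have hB : Defs.hermitian B by exact: Aadj_herm.
have quad (S : 'M[C]_d) : Defs.hermitian S -> ip S (u *m adj u) = ip u (S *m u).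
  by move=> hS; rewrite -{1}[u]adjK -ip_mulr adjK ip_herm.
(* Curvature along [u e_k^*], bounded by Cauchy-Schwarz for the psd form [As i]. *)
have hk (k : 'I_p) : 0 <=
  \sum_i (4 * ip u (As i *m u) * ip (col k X) (As i *m col k X))
    - 2 * ip u (B *m u).
  have FD : mxF F (u *m delta_mx 0 k) by apply: mxFM => //; exact: mxF_delta.
  have adjd : adj (delta_mx 0 k : 'M[C]_(1, p)) = delta_mx k 0.
    by rewrite /adj map_delta_mx trmx_delta.
  have [_] := socp_conditions FD; rewrite -ip_Aadj adjM adjd.
  have -> : u *m delta_mx 0 k *m (delta_mx k 0 *m adj u) = u *m adj u.
    rewrite mulmxA -[u *m _ *m _]mulmxA mul_delta_mx.
    have -> : delta_mx 0 0 = 1%:M :> 'M[C]_1.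
      by apply/matrixP => i j; rewrite !ord1 !mxE.
    by rewrite mulmx1.
  rewrite quad // => /le_trans; apply; rewrite lerB // ler_sum // => i _.
  (* With [x_k] the k-th column of [X], both halves of [x_k u^* + u x_k^*] contribute the real part
     of [u^* A_i x_k]. *)
  have -> : ip (As i) (X *m (delta_mx k 0 *m adj u) + u *m delta_mx 0 k *m adj X) =
     2 * ip u (As i *m col k X).
    rewrite mulmxA -colE ipDr -[u *m _ *m _]mulmxA.
    have -> : delta_mx 0 k *m adj X = adj (col k X) by rewrite colE adjM -adjd adjK.
    have -> : ip (As i) (col k X *m adj u) = ip (As i) (u *m adj (col k X)).
      by rewrite -ip_adj hAi adjM adjK.
    rewrite -[col k X in LHS]adjK -!ip_mulr !adjK ip_mull hAi.
    by rewrite -(ip_herm _ u (hAi i)) ipC -mulr2n mulr_natl.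
  rewrite exprMn -mulrA; have := psd_CS (hA i).2 Fu (mxF_col k FX); lra.
have : 0 <= \sum_(k < p)
  (\sum_i (4 * ip u (As i *m u) * ip (col k X) (As i *m col k X))
    - 2 * ip u (B *m u)) by apply: sumr_ge0 => k _; exact: hk.
rewrite sumrB sumr_const card_ord exchange_big /= -mulr_natl.
under eq_bigr => i _ do rewrite -mulr_sumr -ip_gram // -mulrA.
rewrite -mulr_sumr; lra.
Qed.

Lemma socp_hessian m (N : 'M[C]_(d, m)) : mxF F N ->
  0 <= 2 * \sum_i ip (As i) (N *m adj N) * ip (As i) (X *m adj X)
       - p%:R * ip B (N *m adj N).
Proof.
move=> FN.
have hAi i : Defs.hermitian (As i) by have [_ []] := hA i.
have hB : Defs.hermitian B by exact: Aadj_herm.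
have : 0 <= \sum_k
  (2 * \sum_i ip (col k N) (As i *m col k N) * ip (As i) (X *m adj X)
    - p%:R * ip (col k N) (B *m col k N)).
  by apply: sumr_ge0 => k _; apply: socp_hessian_col; exact: mxF_col.
rewrite sumrB -!mulr_sumr exchange_big /= -ip_gram //.
by under eq_bigr => i _ do rewrite -mulr_suml -ip_gram //.
Qed.

End Socp.
End CriticalPoints.

(** * Estimates for the error [X X^* - Z] and their combination *)

Section ErrorBound.
Variable R : realType.
Local Notation C := (complex R).
Local Notation rc := (real_complex R).
Variable F : field_choice.

(** A factor of [Z] with orthogonal columns: the diagonal [V^* V] later bounds [N V^*] from below
    column by column. *)
Lemma spectral_factor d r (U : 'M[C]_(d, r)) (l : 'rV[R]_r) : adj U *m U = 1%:M ->
  (forall j, 0 < l 0 j) ->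
  let V := U *m diag_mx (map_mx (real_complex R) (map_mx Num.sqrt l)) in
  [/\ V *m adj V = U *m diag_mx (map_mx (real_complex R) l) *m adj U,
      adj V *m V = diag_mx (map_mx (real_complex R) l) & PU U *m V = V].
Proof.
move=> hU l0 V; set D := diag_mx _ in V *.
have aD : adj D = D.
  rewrite /adj map_diag_mx tr_diag_mx; congr diag_mx.
  by apply/matrixP => i j; rewrite !mxE; exact: conj_rc.
have DD : D *m D = diag_mx (map_mx (real_complex R) l).
  rewrite mulmx_diag; congr diag_mx; apply/matrixP => i j.
  by rewrite (ord1 i) !mxE -rmorphM -expr2 sqr_sqrtr // ltW.
split.
- by rewrite /V adjM aD mulmxA -[U *m D *m D]mulmxA DD.
- by rewrite /V adjM aD mulmxA -[D *m adj U *m U]mulmxA hU mulmx1.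
- by rewrite /V mulmxA (PU_U hU).
Qed.

Lemma PTperp_factor d r m (U : 'M[C]_(d, r)) (V : 'M[C]_(d, m)) :
  adj U *m U = 1%:M -> PU U *m V = V -> PTperp U (V *m adj V) = 0.
Proof.
by move=> hU hV; rewrite PTperp_gram -{1}hV mulmxA PUperp_PU // !mul0mx.
Qed.

Section Factor.
Variables (d r p : nat) (U V : 'M[C]_(d, r)) (X : 'M[C]_(d, p)).
Hypotheses (hU : adj U *m U = 1%:M) (hV : PU U *m V = V).
Local Notation H := (X *m adj X - V *m adj V).
Local Notation M := (PUperp U *m X).

(** [V V^*] has no normal part, so the normal part of the error is a Gram matrix: psd, with trace
    [|M|^2]. *)
Lemma PTperp_error : PTperp U H = M *m adj M.
Proof. by rewrite PTperpB (PTperp_factor hU hV) subr0 PTperp_gram. Qed.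

Lemma ip_error_le B : mxF F U -> mxF F X -> Defs.hermitian B ->
  ip B H <= opnorm F B * (Num.sqrt (2 * r%:R) * nm (PT U H) + ip M M).
Proof.
move=> FU FX hB; rewrite ipC -{1}(PTD_PTperp U H) ipDl (ip_PT hU) mulrDr lerD //.
  apply: (le_trans (ip_le_nm _ _)); rewrite mulrC mulrA ler_wpM2r ?nm_ge0 //.
  by rewrite (mulrC (opnorm F B)) nm_PT_le.
by rewrite PTperp_error ipC opnorm_gram //; apply: mxFM => //; exact: mxF_PUperp.
Qed.

Lemma residual_le (l : 'rV[R]_r) (lr : R) (J : 'M[C]_(p, r)) :
  adj V *m V = diag_mx (map_mx (real_complex R) l) -> (forall j, lr <= l 0 j) ->
  adj (V - X *m J) *m X = 0 ->
  lr * ip (V - X *m J) (V - X *m J) <= ip (PT U H) (PT U H).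
Proof.
move=> VV hl; set N := V - X *m J => NX.
(* Here [V = N + X J], and [N^* X = 0] removes the second term. *)
have NV : adj N *m V = adj N *m N.
  by rewrite (mulmxBr _ V (X *m J) : adj N *m N = _) mulmxA NX mul0mx subr0.
set q := ip (N *m adj V) (N *m adj V).
have lq : lr * ip N N <= q.
  rewrite /q ip_mulr adjK -mulmxA VV !(ip_cols N) mulr_sumr; apply: ler_sum => k _.
  have -> : col k (N *m diag_mx (map_mx (real_complex R) l)) = rc (l 0 k) *: col k N.
    by apply/matrixP => i j; rewrite mul_mx_diag !mxE mulrC.
  by rewrite ipZr ler_wpM2r ?ip_ge0.
have qE : q = - ip (N *m adj V) (H *m PU U).
  (* The columns of [V] lie in the range of [U], so [N V^*] absorbs [P_U]. *)
  have -> : ip (N *m adj V) (H *m PU U) = ip (N *m adj V) H.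
    by rewrite -{1}(adj_PU U) -ip_mulr -mulmxA -{1}(adj_PU U) -adjM hV.
  rewrite ipBr 2![in RHS]ip_mull !mulmxA NX mul0mx ip0r sub0r opprK NV.
  by rewrite -mulmxA -ip_mull.
(* [q = |N V^*|^2 = - <N V^*, H P_U>], so Cauchy-Schwarz gives [q <= |H P_U|^2]. *)
have qle : q <= ip (H *m PU U) (H *m PU U).
  have [q0|q0] := eqVneq q 0; first by rewrite q0 ip_ge0.
  have qp : 0 < q by rewrite lt_neqAle eq_sym q0 ip_ge0.
  have := ip_CS (N *m adj V) (H *m PU U).
  by rewrite -sqrrN -qE expr2 ler_pM2l.
apply: (le_trans lq); apply: (le_trans qle).
by rewrite (ip_PT_sq hU) lerDl ip_ge0.
Qed.

Variables (n : nat) (As : 'I_n -> 'M[C]_d) (xi lam : 'cV[R]_n) (eps : R).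
Hypotheses (FU : mxF F U) (FV : mxF F V) (FX : mxF F X).
Hypothesis hA : forall i, mxF F (As i) /\ psd F (As i).

Lemma ip_Aadj_le (z : 'cV[R]_n) S : ip (Aadj As z) S <= enorm z * enorm (Aop As S).
Proof.
rewrite ip_Aadj; apply: (le_trans (ler_norm _)).
rewrite -sqrtr_sqr -sqrtrM; last by apply: sumr_ge0 => i _; exact: sqr_ge0.
apply: ler_wsqrtr; under [X in _ <= _ * X]eq_bigr => i _ do rewrite AopE.
exact: sum_CS.
Qed.

(** The certificate is paired with [H]. Its tangent part contributes at least [- eps |P_T H|], its
    normal part at least [<P_U^perp, M M^*> = |M|^2], and the whole is at most [|lam| |A H|]. *)
Lemma dual_bound : loewner_ge F (PTperp U (Aadj As lam)) (PUperp U) ->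
  nm (PT U (Aadj As lam)) <= eps ->
  ip M M <= eps * nm (PT U H) + enorm lam * enorm (Aop As H).
Proof.
move=> hY hT; set Y := Aadj As lam.
have FM : mxF F M by apply: mxFM => //; exact: mxF_PUperp.
have h1 : ip Y H = ip (PT U Y) (PT U H) + ip (PTperp U Y) (M *m adj M).
  by rewrite -{1}(PTD_PTperp U Y) ipDl (ip_PT hU) (ip_PTperp hU) PTperp_error.
have h2 : - (eps * nm (PT U H)) <= ip (PT U Y) (PT U H).
  have -> : ip (PT U Y) (PT U H) = - ip (PT U Y) (- PT U H) by rewrite ipNr opprK.
  rewrite lerN2; apply: (le_trans (ip_le_nm _ _)).
  have -> : nm (- PT U H) = nm (PT U H) by rewrite /nm ipNl ipNr opprK.
  by rewrite ler_wpM2r ?nm_ge0.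
have h3 : ip M M <= ip (PTperp U Y) (M *m adj M).
  have := psd_gram_ge0 hY FM; rewrite ipBl subr_ge0; congr (_ <= _).
  by rewrite -{1}[M]adjK -ip_mulr adjK mulmxA (PUperp_idem hU).
have h4 := ip_Aadj_le lam H.
rewrite addrC -lerBlDr -[leLHS]addrC.
apply: le_trans h4; rewrite -/Y h1; exact: lerD.
Qed.

(** The gradient condition gives [<B, N N^*> = <B, V V^*> = - <B, H>], and [B = A^* xi - A^* A H]
    evaluates the last pairing. *)
Lemma socp_bound (J : 'M[C]_(p, r)) :
  let y := Aop As (V *m adj V) + xi in
  let N := V - X *m J in
  mxF F J -> socp F As y X ->
  0 <= 2 * ip (Aadj As y) (N *m adj N)
       + (p%:R + 2) * (ip (Aadj As xi) H - enorm (Aop As H) ^+ 2).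
Proof.
move=> y N FJ hX.
have FN : mxF F N by apply: mxFB => //; exact: mxFM.
set B := Aadj As (y - Aop As (X *m adj X)).
have hB : Defs.hermitian B by apply: Aadj_herm => i; have [_ []] := hA i.
have grad D : mxF F D -> ip B (X *m adj D) = 0.
  exact: (socp_gradient hX hA).
have BN : ip B (N *m adj N) = ip B (V *m adj V).
  have e1 : ip B (X *m (J *m adj V)) = 0.
    rewrite -[J *m _]adjK grad //; apply: mxF_adj.
    by apply: mxFM => //; exact: mxF_adj.
  have e2 : ip B (V *m adj J *m adj X) = 0.
    by rewrite -ip_adj hB !adjM !adjK.
  have e3 : ip B (X *m (J *m adj J *m adj X)) = 0.
    rewrite -[J *m _ *m _]adjK grad //; apply: mxF_adj.
    by apply: mxFM; [apply: mxFM => //|]; exact: mxF_adj.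
  rewrite /N adjB adjM mulmxBl !mulmxBr !ipBr -!mulmxA e1.
  by rewrite [V *m (_ *m _)]mulmxA e2 [J *m (_ *m _)]mulmxA e3 !subr0.
have BH : ip B H = ip (Aadj As xi) H - enorm (Aop As H) ^+ 2.
  rewrite enorm_sq !ip_Aadj -sumrB; apply: eq_bigr => i _.
  by rewrite subAopE AopE [y i 0]mxE AopE ipBr; ring.
have BV : ip B (V *m adj V) = - ip B H.
  by rewrite ipBr (grad X FX) sub0r opprK.
(* Writing the measurements of [X X^*] as [y - e] splits off one more copy of [<B, N N^*>]; doubled,
   it turns the factor p into p + 2. *)
have AN : \sum_i ip (As i) (N *m adj N) * ip (As i) (X *m adj X) =
    ip (Aadj As y) (N *m adj N) - ip B (N *m adj N).
  rewrite !ip_Aadj -sumrB; apply: eq_bigr => i _.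
  by rewrite subAopE; ring.
have := socp_hessian hX hA FX FN; rewrite AN -/B BN BV -BH.
move: (ip B _) (ip _ (N *m _)) => h g; congr (_ <= _); ring.
Qed.

End Factor.

(* [a] is the tangent error, [b] the trace of the normal error, [m] the scaled
   measurement error, [w] the squared residual of the least-squares fit, and [q]
   the factor [sqrt (2 r)].  For [n = 0] the divisions by [n] yield [0]. *)
Lemma combine_bounds (n p tau kap kap' mu L eps Lam lr a b w m opy opx q : R) :
  0 < lr -> 0 <= opy -> 0 <= opx -> 1 <= q -> 0 <= n -> 0 <= p ->
  0 <= eps -> 0 <= Lam -> 0 < mu -> 0 < L -> L * eps < mu ->
  0 <= a -> 0 <= b -> 0 <= w -> (n = 0 -> m = 0) -> 0 <= m ->
  mu * a - L * b <= m ->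
  b <= eps * a + Lam * m ->
  lr * w <= a ^+ 2 ->
  0 <= 2 * (opy * w) + (p + 2) * (opx * (q * a + b) - n * m ^+ 2) ->
  kap = (1 + L * Lam) / (mu - L * eps) ->
  kap' = (1 + eps + Lam * (L + mu)) / (mu - L * eps) ->
  tau = 2 * kap ^+ 2 * (opy / (n * lr)) - 2 ->
  tau < p ->
  a + b <= (p + 2) / (p - tau) * kap' ^+ 2 * q * (opx / n).
Proof.
move=> lr0 opy0 opx0 q1 n0 p0 eps0 Lam0 mu0 L0 gap a0 b0 w0 nm m0.
move=> h1 h2 h3 h4 kE k'E tauE htau.
have gp : 0 < mu - L * eps by lra.
(* The bound on [b] is inserted into the isometry inequality, leaving
   [(mu - L * eps) * a <= (1 + L * Lam) * m]. *)
have ak : a <= kap * m.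
  rewrite kE mulrAC ler_pdivlMr //; nra.
have sk : a + b <= kap' * m.
  have -> : kap' * m = (1 + eps) * (kap * m) + Lam * m by rewrite kE k'E; field; lra.
  nra.
have rhs0 : 0 <= (p + 2) / (p - tau) * kap' ^+ 2 * q * (opx / n).
  apply: mulr_ge0; last exact: divr_ge0.
  apply: mulr_ge0; last lra.
  by apply: mulr_ge0; [apply: divr_ge0; lra | exact: sqr_ge0].
(* For [n = 0] the measurement error [m] vanishes, hence [a + b <= 0], and nonnegativity of the
   right side suffices. *)
have [nz|nz] := eqVneq n 0; first by move: sk; rewrite (nm nz) mulr0; lra.
have np : 0 < n by rewrite lt_neqAle eq_sym nz.
have [s0|s0] := leP (a + b) 0; first lra.
(* [tau] is chosen so that subtracting the residual term from [(p + 2) * (n * m ^+ 2)] leaves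
   exactly the factor [p - tau]. *)
have key : n * m ^+ 2 * (p - tau) <= (p + 2) * (opx * (q * (a + b))).
  have -> : n * m ^+ 2 * (p - tau) =
      (p + 2) * (n * m ^+ 2) - 2 * opy * ((kap * m) ^+ 2 / lr).
    by rewrite tauE; field; lra.
  have : w <= (kap * m) ^+ 2 / lr by rewrite ler_pdivlMr // mulrC; nra.
  move=> /(ler_wpM2l opy0).
  have : opx * (q * a + b) <= opx * (q * (a + b)) by apply: ler_wpM2l => //; nra.
  move=> /(ler_wpM2l (_ : 0 <= p + 2)) => /(_ ltac:(lra)).
  lra.
have sq : (a + b) ^+ 2 <= kap' ^+ 2 * m ^+ 2.
  by rewrite -exprMn ler_sqr ?nnegrE; lra.
have ptau : 0 < p - tau by lra.
have m2 : m ^+ 2 <= (p + 2) * (opx * (q * (a + b))) / (n * (p - tau)).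
  rewrite ler_pdivlMr ?mulr_gt0 //; lra.
(* A quadratic bound on [a + b] by a multiple of [a + b]; one positive factor cancels. *)
have := le_trans sq (ler_wpM2l (sqr_ge0 kap') m2).
have -> : kap' ^+ 2 * ((p + 2) * (opx * (q * (a + b))) / (n * (p - tau))) =
  (a + b) * ((p + 2) / (p - tau) * kap' ^+ 2 * q * (opx / n)).
  by field; lra.
by rewrite expr2 ler_pM2l.
Qed.

End ErrorBound.

(** * Application of the estimates to a given critical point *)

Theorem theorem5 (R : realType) (F : field_choice) (n d r p : nat)
  (As : 'I_n -> 'M[complex R]_d) (Xs U : 'M[complex R]_(d, r))
  (l : 'rV[R]_r) (lr : R) (xi lam : 'cV[R]_n) (eps mu L : R) :
  (forall i, mxF F (As i) /\ psd F (As i)) ->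
  mxF F Xs ->
  \rank (Xs *m adj Xs) = r ->
  mxF F U -> adj U *m U = 1%:M ->
  (forall j, 0 < l 0 j) ->
  Xs *m adj Xs = U *m diag_mx (map_mx (real_complex R) l) *m adj U ->
  (forall j, lr <= l 0 j) -> (exists j, l 0 j = lr) ->
  0 <= eps ->
  loewner_ge F (PTperp U (Aadj As lam)) (PUperp U) ->
  frob (PT U (Aadj As lam)) <= eps ->
  0 < mu -> 0 < L ->
  (forall H : 'M[complex R]_d, inHd F H -> psd F (PTperp U H) ->
     mu * frob (PT U H) - L * rtr (PTperp U H)
       <= enorm (Aop As H) / Num.sqrt n%:R) ->
  L * eps < mu ->
  let Zs := Xs *m adj Xs in
  let y := Aop As Zs + xi in
  let tau := 2 * ((1 + L * Num.sqrt n%:R * enorm lam) / (mu - L * eps)) ^+ 2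
               * (opnorm F (Aadj As y) / (n%:R * lr)) - 2 in
  tau < p%:R ->
  forall X : 'M[complex R]_(d, p), mxF F X -> socp F As y X ->
    frob (X *m adj X - Zs)
      <= frob (PT U (X *m adj X - Zs)) + rtr (PTperp U (X *m adj X)) /\
    frob (PT U (X *m adj X - Zs)) + rtr (PTperp U (X *m adj X))
      <= (p%:R + 2) / (p%:R - tau)
         * ((1 + eps + Num.sqrt n%:R * enorm lam * (L + mu)) / (mu - L * eps)) ^+ 2
         * Num.sqrt (2 * r%:R) * (opnorm F (Aadj As xi) / n%:R).

Proof.
move=> hA _ _ FU hU l0 hZ hl [j0 lrE] eps0 hY hT mu0 L0 hiso gap.
move=> Zs y tau htau X FX hX.
(* From here on [V] replaces [Xs] as the factor of [Zs]. *)
have [VV' VV hV] := spectral_factor hU l0.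
set V := U *m _ in VV' VV hV; rewrite -VV' in hZ.
have FV : mxF F V by apply: mxFM => //; exact: mxF_diag.
have ZE : Zs = V *m adj V := hZ.
have [J FJ NX] := least_squares FX FV.
pose M := PUperp U *m X.
set H := X *m adj X - Zs.
have FH : mxF F H.
  by apply: mxFB; rewrite ?ZE; apply: mxFM => //; exact: mxF_adj.
have hH : Defs.hermitian H.
  by rewrite /Defs.hermitian /H ZE adjB !adjM !adjK.
have PH : PTperp U H = M *m adj M by rewrite /H ZE PTperp_error.
have bE : rtr (PTperp U (X *m adj X)) = ip M M by rewrite PTperp_gram trace_gram.
have lr0 : 0 < lr by rewrite -lrE l0.
split; rewrite bE.
  rewrite -[frob H]/(nm H) -{1}(PTD_PTperp U H); apply: (le_trans (nm_triangle _ _)).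
  by rewrite lerD2l PH nm_gram_le.
rewrite -[frob _]/(nm (PT U H)).
set E := enorm (Aop As H).
have E0 : 0 <= E := sqrtr_ge0 _.
have n0E : n = 0%N -> E = 0.
  move=> n0; rewrite /E /enorm big1 ?sqrtr0 // => i.
  by have := ltn_ord i; rewrite {2}n0.
(* For [n = 0] both sides are 0, as [E] is then the norm of an empty vector. *)
have EE : E = Num.sqrt n%:R * (E / Num.sqrt n%:R).
  have [/n0E ->|n0] := eqVneq n 0%N; first by rewrite mul0r mulr0.
  by rewrite mulrC divfK // gt_eqF // sqrtr_gt0 ltr0n lt0n.
have E2 : E ^+ 2 = n%:R * (E / Num.sqrt n%:R) ^+ 2.
  by rewrite {1}EE exprMn sqr_sqrtr.
set Lam := Num.sqrt n%:R * enorm lam.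
have tauE : tau = 2 * ((1 + L * Lam) / (mu - L * eps)) ^+ 2
    * (opnorm F (Aadj As y) / (n%:R * lr)) - 2 by rewrite /tau /Lam (mulrA L).
apply: (@combine_bounds R n%:R p%:R tau _ _ mu L eps Lam lr (nm (PT U H)) (ip M M)
  (ip (V - X *m J) (V - X *m J)) (E / Num.sqrt n%:R) (opnorm F (Aadj As y))
  (opnorm F (Aadj As xi)) (Num.sqrt (2 * r%:R))); try exact: erefl.
- exact: lr0.
- exact: opnorm_ge0.
- exact: opnorm_ge0.
(* The index [j0] of the smallest eigenvalue shows that r is positive. *)
- rewrite -[leLHS]sqrtr1 ler_wsqrtr // -natrM ler1n muln_gt0 /=.
  exact: leq_ltn_trans (ltn_ord j0).
- exact: ler0n.
- exact: ler0n.
- exact: eps0.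
- by rewrite mulr_ge0 ?sqrtr_ge0.
- exact: mu0.
- exact: L0.
- exact: gap.
- exact: nm_ge0.
- exact: ip_ge0.
- exact: ip_ge0.
- by move/eqP; rewrite pnatr_eq0 => /eqP/n0E ->; rewrite mul0r.
- by rewrite divr_ge0 ?sqrtr_ge0.
(* The isometry applies to [H] because its normal part [M M^*] is psd. *)
- have := hiso H (conj FH hH); rewrite PH trace_gram; apply; exact: gram_psd.
- have -> : Lam * (E / Num.sqrt n%:R) = enorm lam * E.
    by rewrite [in RHS]EE /Lam; ring.
  by rewrite /E /H ZE; exact: (dual_bound hU hV).
- by rewrite nm_sq /H ZE; exact: (residual_le hU hV VV hl NX).
- have hB z : Defs.hermitian (Aadj As z).
    by apply: Aadj_herm => i; have [_ []] := hA i.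
  have FN : mxF F (V - X *m J) by apply: mxFB => //; exact: mxFM.
  have yE : y = Aop As (V *m adj V) + xi by rewrite /y ZE.
  have := @socp_bound _ F _ _ _ V X _ As xi FV FX hA J; rewrite -yE => /(_ FJ hX).
  rewrite -ZE -/H -/E -E2 => /le_trans; apply; apply: lerD.
    by apply: ler_wpM2l; last exact: opnorm_gram.
  apply: ler_wpM2l; first by rewrite addr_ge0.
  have := ip_error_le hU hV FU FX (hB xi); rewrite -ZE -/H => h.
  by rewrite lerD2r; exact: h.
- exact: tauE.
- exact: htau.
Qed.
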